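(* Let $K$ be an absolutely weakly sequentially compact subset of a Banach lattice $E$. If $E$ is separable or the closed unit ball $B_{E^{**}}$ of $E^{**}$ is absolutely weak$^*$ compact, then $K$ is absolutely weakly compact.
   Context: Banach lattices are real; $E^*$ denotes the topological dual of $E$ and $E^{**}$ its bidual. The absolute weak topology $|\sigma|(E,E^* )$ on a Banach lattice $E$ is the locally convex-solid topology generated by the lattice seminorms $p_{x^*}(x) = |x^*|(|x|)$, $x \in E$, where $x^*$ ranges over $E^*$. A subset $K$ of $E$ is absolutely weakly compact if it is compact for $|\sigma|(E,E^* )$; it is absolutely weakly sequentially compact if every sequence in $K$ has a subsequence that converges in $|\sigma|(E,E^* )$ to an element of $K$. For a Banach lattice $F$, the absolute weak$^*$ topology $|\sigma|(F^*,F)$ on $F^*$ is the locally convex-solid topology generated by the lattice seminorms $q_x(x^* ) = |x^*|(|x|)$, $x^* \in F^*$, where $x$ ranges over $F$. A subset of $F^*$ is absolutely weak$^*$ compact if it is compact for $|\sigma|(F^*,F)$; for $B_{E^{**}}$ this is applied with $F = E^*$, so the topology is $|\sigma|(E^{**},E^* )$. *)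

(* Defs.v *)
From HB Require Import structures.
From mathcomp Require Import all_boot all_order all_algebra.
From mathcomp Require Import all_classical all_reals all_analysis.
From mathcomp Require Import ring lra.

Set Implicit Arguments.
Unset Strict Implicit.
Unset Printing Implicit Defensive.

Import Order.TTheory GRing.Theory Num.Theory.
Import numFieldNormedType.Exports.

Local Open Scope classical_set_scope.
Local Open Scope ring_scope.

Reserved Notation "x ≼ y" (at level 70, no associativity).

(** The order is not taken from [Order.Lattice]: Hierarchy Builder only accepts a
structure joining [Order.Lattice] and [GRing.Lmodule] if it is declared before
[Num.RealDomain]. *)
HB.mixin Record Lmodule_isRiesz (R : numDomainType) E & GRing.Lmodule R E := {
  rle : E -> E -> Prop;
  rle_refl : forall x, rle x x;
  rle_anti : forall x y, rle x y -> rle y x -> x = y;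
  rle_trans : forall y x z, rle x y -> rle y z -> rle x z;
  rle_add2r : forall x y z, rle x y -> rle (x + z) (y + z);
  rle_scale : forall (a : R) x y, 0 <= a -> rle x y -> rle (a *: x) (a *: y);
  rsup : E -> E -> E;
  rinf : E -> E -> E;
  rsupP : forall x y z, rle (rsup x y) z <-> rle x z /\ rle y z;
  rinfP : forall x y z, rle z (rinf x y) <-> rle z x /\ rle z y
}.

#[short(type="rieszType")]
HB.structure Definition Riesz (R : numDomainType) :=
  {E of GRing.Lmodule R E & Lmodule_isRiesz R E}.

Notation "x ≼ y" := (rle x y) : ring_scope.

Definition rabs (R : numDomainType) (E : rieszType R) (x : E) : E :=
  rsup x (- x).

HB.mixin Record NormedModule_Riesz_isBanachLattice (R : realType) E
    & CompleteNormedModule R E & Riesz R E := {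
  lattice_norm : forall x y : E, rabs x ≼ rabs y -> `|x| <= `|y|
}.

#[short(type="banachLatticeType")]
HB.structure Definition BanachLattice (R : realType) :=
  {E of CompleteNormedModule R E & Riesz R E
      & NormedModule_Riesz_isBanachLattice R E}.

Section riesz_theory.
Variables (R : realFieldType) (E : rieszType R).
Implicit Types x y z a b : E.

Definition rpos x : E := rsup x 0.

Lemma rsup_l x y : x ≼ rsup x y.
Proof. by have [/(_ (rle_refl _))[]] := rsupP x y (rsup x y). Qed.

Lemma rsup_r x y : y ≼ rsup x y.
Proof. by have [/(_ (rle_refl _))[]] := rsupP x y (rsup x y). Qed.

Lemma rinf_l x y : rinf x y ≼ x.
Proof. by have [/(_ (rle_refl _))[]] := rinfP x y (rinf x y). Qed.

Lemma rinf_r x y : rinf x y ≼ y.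
Proof. by have [/(_ (rle_refl _))[]] := rinfP x y (rinf x y). Qed.

Lemma rle_sub x y : x ≼ y <-> 0 ≼ y - x.
Proof.
split=> [xy|xy].
  by have := rle_add2r _ _ (- x) xy; rewrite subrr.
by have := rle_add2r _ _ x xy; rewrite add0r subrK.
Qed.

Lemma rle_opp x y : x ≼ y -> - y ≼ - x.
Proof. by move=> /rle_sub xy; apply/rle_sub; rewrite opprK addrC. Qed.

Lemma rle_add x y a b : x ≼ y -> a ≼ b -> x + a ≼ y + b.
Proof.
move=> xy ab; apply: (rle_trans _ _ _ (rle_add2r _ _ a xy)).
by rewrite ![y + _]addrC; exact: rle_add2r.
Qed.

Lemma radd_ge0 x y : 0 ≼ x -> 0 ≼ y -> 0 ≼ x + y.
Proof. by move=> x0 y0; have := rle_add x0 y0; rewrite addr0. Qed.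

Lemma rscale_ge0 (c : R) x : 0 <= c -> 0 ≼ x -> 0 ≼ c *: x.
Proof. by move=> c0 /(rle_scale _ _ _ c0); rewrite scaler0. Qed.

Lemma rpos_ge0 x : 0 ≼ rpos x. Proof. exact: rsup_r. Qed.

Lemma rpos_id x : 0 ≼ x -> rpos x = x.
Proof.
move=> x0; apply: (rle_anti _ _ _ (rsup_l _ _)).
by apply/rsupP; split => //; exact: rle_refl.
Qed.

Lemma rpos_neg x : 0 ≼ x -> rpos (- x) = 0.
Proof.
move=> /rle_opp; rewrite oppr0 => x0; apply: (rle_anti _ _ _ (rpos_ge0 _)).
by apply/rsupP; split => //; exact: rle_refl.
Qed.

Lemma rposBneg x : rpos x - rpos (- x) = x.
Proof.
suff -> : rpos x = rpos (- x) + x by rewrite addrAC subrr add0r.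
apply: rle_anti.
  apply/rsupP; split.
    by have := rle_add2r _ _ x (rpos_ge0 (- x)); rewrite add0r.
  by have := rle_add2r _ _ x (rsup_l (- x) 0); rewrite addNr.
suff : rpos (- x) ≼ rpos x - x by move=> /(rle_add2r _ _ x); rewrite subrK.
apply/rsupP; split.
  by have := rle_add2r _ _ (- x) (rpos_ge0 x); rewrite add0r.
by have := rle_add2r _ _ (- x) (rsup_l x 0); rewrite subrr.
Qed.

Lemma rabs_lb x : x ≼ rabs x. Proof. exact: rsup_l. Qed.

Lemma rabs_lbN x : - x ≼ rabs x. Proof. exact: rsup_r. Qed.

Lemma rabs_ge0 x : 0 ≼ rabs x.
Proof.
have := rle_add (rabs_lb x) (rabs_lbN x); rewrite subrr.
have h : (0 : R) <= 2^-1 by rewrite invr_ge0.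
move=> /(rscale_ge0 h).
by rewrite -[rabs x]scale1r -scalerDl scalerA mulVf// scale1r.
Qed.

Lemma rabs_id x : 0 ≼ x -> rabs x = x.
Proof.
move=> x0; apply: (rle_anti _ _ _ (rsup_l _ _)); apply/rsupP; split.
  exact: rle_refl.
by apply: (rle_trans _ _ _ _ x0); have := rle_opp x0; rewrite oppr0.
Qed.

Lemma riesz_decomposition y a b : 0 ≼ y -> 0 ≼ a -> 0 ≼ b -> y ≼ a + b ->
  exists y1 y2, [/\ y = y1 + y2, 0 ≼ y1, y1 ≼ a, 0 ≼ y2 & y2 ≼ b].
Proof.
move=> y0 a0 b0 yab; exists (rinf y a), (y - rinf y a); split.
- by rewrite addrC subrK.
- exact/rinfP.
- exact: rinf_r.
- by have /rle_sub := rinf_l y a.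
- suff : y - b ≼ rinf y a.
    by move=> /rle_sub h; apply/rle_sub; move: h; rewrite !opprB addrCA addrA.
  apply/rinfP; split; apply/rle_sub; rewrite opprB addrCA.
    by rewrite subrr addr0.
  by rewrite addrA; move/rle_sub : yab; rewrite [b + a]addrC.
Qed.

End riesz_theory.

Section dual.
Variables (R : realType) (E : normedModType R).

Definition dual_pred : {pred E -> R} :=
  mem [set f : E -> R | linear f /\ continuous f].

Record dual := Dual { dual_fun :> E -> R ; _ : dual_fun \in dual_pred }.

HB.instance Definition _ := [isSub for dual_fun].
HB.instance Definition _ := [Choice of dual by <:].

Lemma dual_pred_submod_closed : submod_closed dual_pred.
Proof.
split=> [|a f g]; rewrite !inE /=.
  split; last by move=> x; exact: cvg_cst.
  by move=> a x y /=; rewrite scaler0 addr0.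
move=> [lf cf] [lg cg]; split=> [b x y|x] /=.
  rewrite !fctE.
  rewrite lf lg [in RHS]scalerDr [in RHS]scalerA [b * a]mulrC -scalerA.
  by rewrite -addrACA -scalerDr.
apply: cvgD; last exact: cg.
by apply: cvgM; [exact: cvg_cst|exact: cf].
Qed.

HB.instance Definition _ :=
  GRing.isSubmodClosed.Build R (E -> R) dual_pred dual_pred_submod_closed.
HB.instance Definition _ := [SubChoice_isSubLmodule of dual by <:].

Lemma dual_linear (f : dual) : linear f.
Proof. by case: f => f /=; rewrite inE => -[]. Qed.

Lemma dual_continuous (f : dual) : continuous f.
Proof. by case: f => f /=; rewrite inE => -[]. Qed.

HB.instance Definition _ (f : dual) :=
  GRing.isLinear.Build R E R *:%R f (dual_linear f).

Lemma dualP (f g : dual) : (forall x, f x = g x) -> f = g.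
Proof. by move=> fg; apply/val_inj/funext. Qed.

Lemma dual_addE (f g : dual) x : (f + g) x = f x + g x.
Proof. by []. Qed.

Lemma dual_oppE (f : dual) x : (- f) x = - f x.
Proof. by []. Qed.

Lemma dual_scaleE (a : R) (f : dual) x : (a *: f) x = a * f x.
Proof. by []. Qed.

Lemma dual_zeroE x : (0 : dual) x = 0.
Proof. by []. Qed.

Definition dual_norm (f : dual) : R :=
  sup [set `|f x| | x in [set x : E | `|x| <= 1]].

Lemma dual_bounded (f : dual) :
  exists2 M : R, 0 <= M & forall x, `|f x| <= M * `|x|.
Proof.
have := @continuous_linear_bounded R E R 0 f (@dual_continuous f 0).
move=> /linear_boundedP/pinfty_ex_gt0[M M0 fM].
by exists M => //; exact: ltW.
Qed.

Lemma dual_norm_has_ubound (f : dual) :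
  has_ubound [set `|f x| | x in [set x : E | `|x| <= 1]].
Proof.
have [M M0 fM] := dual_bounded f; exists M => _ [x /= x1 <-].
by rewrite (le_trans (fM x))// ler_piMr.
Qed.

Lemma dual_norm_ge0 f : 0 <= dual_norm f.
Proof.
apply: (le_trans (normr_ge0 (f 0))); apply: ub_le_sup.
  exact: dual_norm_has_ubound.
by exists 0 => //=; rewrite normr0.
Qed.

Lemma dual_norm_bound (f : dual) x : `|f x| <= dual_norm f * `|x|.
Proof.
have [->|x0] := eqVneq x 0; first by rewrite linear0 !normr0 mulr0.
rewrite -ler_pdivrMr ?normr_gt0//.
have -> : `|f x| / `|x| = `|f (`|x|^-1 *: x)|.
  by rewrite linearZ/= normrM normfV normr_id mulrC.
apply: ub_le_sup; first exact: dual_norm_has_ubound.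
exists (`|x|^-1 *: x) => //=.
by rewrite normrZ normfV normr_id mulVf// normr_eq0.
Qed.

Lemma dual_norm_le (f : dual) M :
  0 <= M -> (forall x, `|f x| <= M * `|x|) -> dual_norm f <= M.
Proof.
move=> M0 fM; apply: ge_sup; first by exists `|f 0|, 0 => //=; rewrite normr0.
by move=> _ [x /= x1 <-]; rewrite (le_trans (fM x))// ler_piMr.
Qed.

Lemma dual_norm_triangle f g :
  dual_norm (f + g) <= dual_norm f + dual_norm g.
Proof.
apply: dual_norm_le => [|x]; first by rewrite addr_ge0// dual_norm_ge0.
rewrite dual_addE (le_trans (ler_normD _ _))// mulrDl.
by rewrite lerD// dual_norm_bound.
Qed.

Lemma dual_norm_scale_le (a : R) f : dual_norm (a *: f) <= `|a| * dual_norm f.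
Proof.
apply: dual_norm_le => [|x]; first by rewrite mulr_ge0// dual_norm_ge0.
by rewrite dual_scaleE normrM -mulrA ler_wpM2l// dual_norm_bound.
Qed.

Lemma dual_norm_scale (a : R) f : dual_norm (a *: f) = `|a| * dual_norm f.
Proof.
have [->|a0] := eqVneq a 0.
  apply/le_anti; rewrite (dual_norm_scale_le 0)/=.
  by rewrite normr0 mul0r dual_norm_ge0.
apply/le_anti; rewrite dual_norm_scale_le/=.
rewrite -ler_pdivlMl ?normr_gt0// -normfV.
rewrite (le_trans _ (dual_norm_scale_le a^-1 (a *: f)))//.
by rewrite scalerA mulVf// scale1r.
Qed.

Lemma dual_norm_eq0 f : dual_norm f = 0 -> f = 0.
Proof.
move=> f0; apply: dualP => x; rewrite dual_zeroE; apply/eqP.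
by rewrite -normr_le0 (le_trans (dual_norm_bound f x))// f0 mul0r.
Qed.

HB.instance Definition _ := Lmodule_isNormed.Build R dual
  dual_norm_triangle dual_norm_scale dual_norm_eq0.

Lemma dual_normE f : `|f| = dual_norm f.
Proof. by []. Qed.

Lemma dual_norm_ubound (f : dual) x : `|f x| <= `|f| * `|x|.
Proof. exact: dual_norm_bound. Qed.

Lemma mem_dual_pred (f : E -> R) (M : R) : linear f ->
  (forall x, `|f x| <= M * `|x|) -> f \in dual_pred.
Proof.
move=> lf fM; rewrite inE/=; split => //.
pose F : {linear E -> R} := HB.pack f (GRing.isLinear.Build R E R *:%R f lf).
apply: (@bounded_linear_continuous R E R F); apply/linear_boundedP.
exists M; split=> [|r Mr x]; first exact: num_real.
by apply: (le_trans (fM x)); apply: ler_wpM2r => //; exact: ltW.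
Qed.

Lemma dual_complete (F : set_system dual) :
  ProperFilter F -> cauchy F -> cvg F.
Proof.
move=> FF /cauchyP Fc.
have ball_le (h f : dual) (e : R) x : ball h e f -> `|h x - f x| <= e * `|x|.
  rewrite -ball_normE/= => /ltW hf; rewrite -dual_oppE -dual_addE.
  by rewrite (le_trans (dual_norm_bound _ _))// ler_wpM2r.
have Fx (x : E) : cauchy ((fun f : dual => f x) @ F).
  apply/cauchyP => e e0.
  have e'0 : 0 < e / (`|x| + 1) by rewrite divr_gt0// ltr_wpDl.
  have [h Fh] := Fc _ e'0; exists (h x).
  change (F [set f : dual | ball (h x) e (f x)]).
  apply: filterS Fh => f /(@ball_le _ _ _ x) hf; rewrite /= -ball_normE/=.
  apply: (le_lt_trans hf); rewrite mulrAC ltr_pdivrMr ?ltr_wpDl//.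
  by rewrite ltr_pM2l// ltrDl.
pose g x : R := lim ((fun f : dual => f x) @ F).
have cF (x : E) : (fun f : dual => f x) @ F --> g x.
  exact: R_complete.
have g_le (h : dual) (e : R) x : F (ball h e) -> `|h x - g x| <= e * `|x|.
  move=> Fh; have hc : `|h x - f x| @[f --> F] --> `|h x - g x|.
    by apply: cvg_norm; apply: cvgB; [exact: cvg_cst|exact: cF].
  have ec : e * `|x| @[_ --> F] --> e * `|x| by exact: cvg_cst.
  apply: (ler_cvg_to hc ec).
  by apply: filterS Fh => f; exact: ball_le.
have lg : linear g.
  move=> a x y; apply/esym.
  apply: (@cvg_unique _ _ ((fun f : dual => f (a *: x + y)) @ F)) => //;
    last exact: cF.
  have : a *: f x + f y @[f --> F] --> a *: g x + g y.
    by apply: cvgD; [apply: cvgM; [exact: cvg_cst|exact: cF]|exact: cF].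
  by apply: cvg_trans; apply: near_eq_cvg; apply: nearW => f; rewrite linearP.
have [h1 Fh1] := Fc 1 ltr01.
have gb x : `|g x| <= (`|h1| + 1) * `|x|.
  rewrite -[g x](subrK (h1 x)) (le_trans (ler_normD _ _))// addrC mulrDl.
  by rewrite lerD ?dual_norm_bound// distrC g_le.
pose G := Dual (mem_dual_pred lg gb).
apply/cvg_ex; exists G; apply/cvgrPdist_le => e e0.
have [h Fh] := Fc _ (divr_gt0 e0 (ltr0Sn R 1)).
move: (Fh); apply: filterS => f hf.
rewrite [e]splitr -[G](subrK h) -addrA (le_trans (ler_normD _ _))// lerD//.
  apply: dual_norm_le => [|x]; first by rewrite divr_ge0// ltW.
  by rewrite dual_addE dual_oppE distrC g_le.
by move: hf; rewrite -ball_normE/= => /ltW.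
Qed.

HB.instance Definition _ := Uniform_isComplete.Build dual dual_complete.

End dual.

Section dual_lattice.
Variables (R : realType) (E : banachLatticeType R).
Implicit Types (f g h : dual E) (x y a b : E).

Lemma norm_rabs x : `|rabs x| = `|x|.
Proof.
by apply/le_anti/andP; split; apply: lattice_norm;
  rewrite (rabs_id (rabs_ge0 x)); exact: rle_refl.
Qed.

Lemma rle_norm x y : x ≼ y -> - x ≼ y -> `|x| <= `|y|.
Proof.
move=> xy Nxy; apply: lattice_norm; apply: (rle_trans y); last exact: rabs_lb.
exact/rsupP.
Qed.

Lemma norm_rpos_le x : `|rpos x| <= `|x|.
Proof.
rewrite -[leRHS]norm_rabs; have ppos := rpos_ge0 x; apply: rle_norm.
  by apply/rsupP; split; [exact: rabs_lb|exact: rabs_ge0].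
apply: (rle_trans 0); last exact: rabs_ge0.
by rewrite -[0]oppr0; exact: rle_opp.
Qed.

Definition dual_le f g := forall x, 0 ≼ x -> f x <= g x.

Definition dual_posset f x := [set f y | y in [set y | 0 ≼ y /\ y ≼ x]].

Lemma dual_posset_ub f x r : dual_posset f x r -> r <= `|f| * `|x|.
Proof.
move=> [y [y0 yx] <-]; rewrite (le_trans (ler_norm _))//.
rewrite (le_trans (dual_norm_ubound f y))// ler_wpM2l//.
apply: rle_norm => //; apply: (rle_trans 0); last exact: (rle_trans y).
by rewrite -[0]oppr0; exact: rle_opp.
Qed.

Lemma dual_posset_has_ubound f x : has_ubound (dual_posset f x).
Proof. by exists (`|f| * `|x|) => r; exact: dual_posset_ub. Qed.

(* Riesz-Kantorovich formula for the positive part, on the positive cone *)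
Definition dual_pos0 f x : R := sup (dual_posset f x).

Lemma dual_pos0_ub f x y : 0 ≼ y -> y ≼ x -> f y <= dual_pos0 f x.
Proof.
by move=> y0 yx; apply: ub_le_sup; [exact: dual_posset_has_ubound|exists y].
Qed.

Lemma dual_pos0_le f x r : 0 ≼ x ->
  (forall y, 0 ≼ y -> y ≼ x -> f y <= r) -> dual_pos0 f x <= r.
Proof.
move=> x0 fr; apply: ge_sup; last by move=> _ [y [y0 yx] <-]; exact: fr.
by exists (f x), x => //; split => //; exact: rle_refl.
Qed.

Lemma dual_pos0_ge0 f x : 0 ≼ x -> 0 <= dual_pos0 f x.
Proof.
by move=> x0; rewrite -[0](linear0 f) dual_pos0_ub//; exact: rle_refl.
Qed.

Lemma dual_pos0_bound f x : 0 ≼ x -> dual_pos0 f x <= `|f| * `|x|.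
Proof.
by move=> x0; apply: dual_pos0_le => // y y0 yx; apply: dual_posset_ub; exists y.
Qed.

Lemma dual_pos0D f a b : 0 ≼ a -> 0 ≼ b ->
  dual_pos0 f (a + b) = dual_pos0 f a + dual_pos0 f b.
Proof.
move=> a0 b0; apply/le_anti/andP; split.
  apply: dual_pos0_le => [|y y0 yab]; first exact: radd_ge0.
  have [y1 [y2 [-> y10 y1a y20 y2b]]] := riesz_decomposition y0 a0 b0 yab.
  by rewrite linearD lerD// dual_pos0_ub.
rewrite -lerBrDr; apply: dual_pos0_le => // y y0 ya.
rewrite lerBrDr addrC -lerBrDr; apply: dual_pos0_le => // z z0 zb.
rewrite lerBrDr -linearD dual_pos0_ub//; first exact: radd_ge0.
by rewrite addrC; exact: rle_add.
Qed.

Lemma dual_pos0Z_le f (c : R) a : 0 <= c -> 0 ≼ a ->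
  c * dual_pos0 f a <= dual_pos0 f (c *: a).
Proof.
rewrite le_eqVlt => /predU1P[<-|c0] a0.
  rewrite mul0r dual_pos0_ge0// scale0r; exact: rle_refl.
rewrite -ler_pdivlMl//; apply: dual_pos0_le => // y y0 ya.
rewrite ler_pdivlMl// -[c * f y]/(c *: f y) -linearZ dual_pos0_ub//.
  by apply: rscale_ge0 => //; exact: ltW.
by apply: rle_scale => //; exact: ltW.
Qed.

Lemma dual_pos0_0 f : dual_pos0 f 0 = 0.
Proof.
apply/le_anti/andP; split; last by apply: dual_pos0_ge0; exact: rle_refl.
rewrite (le_trans (dual_pos0_bound f (rle_refl _)))//.
by rewrite normr0 mulr0.
Qed.

Lemma dual_pos0Z f (c : R) a : 0 <= c -> 0 ≼ a ->
  dual_pos0 f (c *: a) = c * dual_pos0 f a.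
Proof.
rewrite le_eqVlt => /predU1P[<-|c0] a0.
  by rewrite mul0r scale0r dual_pos0_0.
apply/le_anti/andP; split; last by apply: dual_pos0Z_le => //; exact: ltW.
rewrite -ler_pdivrMl//.
have := @dual_pos0Z_le f c^-1 (c *: a).
rewrite scalerA mulVf ?gt_eqF// scale1r; apply.
  by rewrite invr_ge0 ltW.
by apply: rscale_ge0 => //; exact: ltW.
Qed.

Definition dual_pos_fun f x : R :=
  dual_pos0 f (rpos x) - dual_pos0 f (rpos (- x)).

Lemma dual_pos_funE f x : 0 ≼ x -> dual_pos_fun f x = dual_pos0 f x.
Proof.
by move=> x0; rewrite /dual_pos_fun rpos_id// rpos_neg// dual_pos0_0 subr0.
Qed.

Lemma dual_pos_funB f a b : 0 ≼ a -> 0 ≼ b ->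
  dual_pos_fun f (a - b) = dual_pos0 f a - dual_pos0 f b.
Proof.
move=> a0 b0; rewrite /dual_pos_fun.
set p := rpos (a - b); set n := rpos (- (a - b)).
have pn : p - n = a - b by exact: rposBneg.
have /(congr1 (dual_pos0 f)) : p + b = a + n.
  by apply/eqP; rewrite -subr_eq addrAC pn subrK.
by rewrite !dual_pos0D//; try exact: rpos_ge0; lra.
Qed.

Lemma dual_pos_linear f : linear (dual_pos_fun f).
Proof.
have addF x y : dual_pos_fun f (x + y) = dual_pos_fun f x + dual_pos_fun f y.
  have -> : x + y = (rpos x + rpos y) - (rpos (- x) + rpos (- y)).
    by rewrite opprD addrACA !rposBneg.
  rewrite dual_pos_funB; [|apply: radd_ge0; exact: rpos_ge0..].
  by rewrite !dual_pos0D; try exact: rpos_ge0; rewrite /dual_pos_fun; lra.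
move=> c x y; rewrite addF; congr (_ + _).
rewrite -[RHS]/(c * _); have [c0|c0] := leP 0 c.
  rewrite -[in LHS](rposBneg x) scalerBr dual_pos_funB;
    [|by apply: rscale_ge0 => //; exact: rpos_ge0..].
  by rewrite !dual_pos0Z//; try exact: rpos_ge0; rewrite /dual_pos_fun mulrBr.
have Nc0 : 0 <= - c by rewrite oppr_ge0 ltW.
have -> : c *: x = (- c) *: rpos (- x) - (- c) *: rpos x.
  by rewrite -scalerBr -opprB rposBneg scalerN scaleNr opprK.
rewrite dual_pos_funB; [|by apply: rscale_ge0 => //; exact: rpos_ge0..].
by rewrite !dual_pos0Z//; try exact: rpos_ge0; rewrite /dual_pos_fun; lra.
Qed.

Lemma dual_pos_fun_bound f x : `|dual_pos_fun f x| <= `|f| * `|x|.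
Proof.
rewrite ler_norml; have p0 := dual_pos0_ge0 f (rpos_ge0 x).
have n0 := dual_pos0_ge0 f (rpos_ge0 (- x)).
have pb : dual_pos0 f (rpos x) <= `|f| * `|x|.
  by rewrite (le_trans (dual_pos0_bound _ (rpos_ge0 _)))// ler_wpM2l ?norm_rpos_le.
have nb : dual_pos0 f (rpos (- x)) <= `|f| * `|x|.
  rewrite (le_trans (dual_pos0_bound _ (rpos_ge0 _)))// ler_wpM2l//.
  by rewrite (le_trans (norm_rpos_le _))// normrN.
by rewrite /dual_pos_fun; apply/andP; split; lra.
Qed.

Definition dual_pos f : dual E :=
  Dual (mem_dual_pred (dual_pos_linear f) (@dual_pos_fun_bound f)).

Lemma dual_posE f x : 0 ≼ x -> dual_pos f x = dual_pos0 f x.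
Proof. exact: dual_pos_funE. Qed.

Lemma dual_posP f g :
  dual_le (dual_pos f) g <-> dual_le f g /\ dual_le 0 g.
Proof.
split=> [fg|[fg g0] x x0].
  split=> x x0; apply: le_trans (fg x x0); rewrite dual_posE//.
    by rewrite dual_pos0_ub//; exact: rle_refl.
  exact: dual_pos0_ge0.
rewrite dual_posE//; apply: dual_pos0_le => // y y0 yx.
rewrite (le_trans (fg y y0))// -subr_ge0 -linearB.
by have /rle_sub/g0 := yx; rewrite dual_zeroE.
Qed.

Lemma dual_le_refl f : dual_le f f. Proof. by []. Qed.

Lemma dual_le_anti f g : dual_le f g -> dual_le g f -> f = g.
Proof.
move=> fg gf; apply: dualP => x.
have e y : 0 ≼ y -> f y = g y.
  by move=> y0; apply/le_anti; rewrite fg// gf.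
by rewrite -(rposBneg x) !linearB/= !e//; exact: rpos_ge0.
Qed.

Lemma dual_le_trans g f h : dual_le f g -> dual_le g h -> dual_le f h.
Proof. by move=> fg gh x x0; exact: le_trans (fg x x0) (gh x x0). Qed.

Lemma dual_le_add2r f g h : dual_le f g -> dual_le (f + h) (g + h).
Proof. by move=> fg x x0; rewrite !dual_addE lerD2r fg. Qed.

Lemma dual_le_scale (c : R) f g : 0 <= c -> dual_le f g ->
  dual_le (c *: f) (c *: g).
Proof. by move=> c0 fg x x0; rewrite !dual_scaleE ler_wpM2l// fg. Qed.

Definition dual_sup f g : dual E := f + dual_pos (g - f).

Definition dual_inf f g : dual E := f - dual_pos (f - g).

Lemma dual_supP f g h :
  dual_le (dual_sup f g) h <-> dual_le f h /\ dual_le g h.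
Proof.
have e : dual_le (dual_sup f g) h <-> dual_le (dual_pos (g - f)) (h - f).
  by split=> + x x0 => /(_ x x0); rewrite !(dual_addE, dual_oppE); lra.
apply: (iff_trans e); apply: (iff_trans (dual_posP _ _)).
split=> -[h1 h2]; split=> x x0; move: (h1 x x0) (h2 x x0);
  by rewrite !(dual_addE, dual_oppE, dual_zeroE); lra.
Qed.

Lemma dual_infP f g h :
  dual_le h (dual_inf f g) <-> dual_le h f /\ dual_le h g.
Proof.
have e : dual_le h (dual_inf f g) <-> dual_le (dual_pos (f - g)) (f - h).
  by split=> + x x0 => /(_ x x0); rewrite !(dual_addE, dual_oppE); lra.
apply: (iff_trans e); apply: (iff_trans (dual_posP _ _)).
split=> -[h1 h2]; split=> x x0; move: (h1 x x0) (h2 x x0);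
  by rewrite !(dual_addE, dual_oppE, dual_zeroE); lra.
Qed.

HB.instance Definition _ := Lmodule_isRiesz.Build R (dual E)
  dual_le_refl dual_le_anti dual_le_trans dual_le_add2r dual_le_scale
  dual_supP dual_infP.

Lemma dual_rleE f g : f ≼ g <-> forall x, 0 ≼ x -> f x <= g x.
Proof. by []. Qed.

Lemma dual_rabs_bound f x : `|f x| <= rabs f (rabs x).
Proof.
have fl : dual_le f (rabs f) := rabs_lb f.
have fr : dual_le (- f) (rabs f) := rabs_lbN f.
move: (rabs f) fl fr => g fl fr.
have p0 : 0 ≼ rabs x + x.
  by have /rle_sub := rabs_lbN x; rewrite opprK.
have n0 : 0 ≼ rabs x - x by have /rle_sub := rabs_lb x.
move: (fl _ p0) (fl _ n0) (fr _ p0) (fr _ n0).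
rewrite !dual_oppE !linearB !linearD/= => *.
by rewrite ler_norml; apply/andP; split; lra.
Qed.

Lemma dual_rabs_le_norm f x : 0 ≼ x -> rabs f x <= `|f| * `|x|.
Proof.
move=> x0; rewrite [rabs f x]dual_addE [X in _ + X]dual_posE//.
rewrite addrC -lerBrDr; apply: dual_pos0_le => // y y0 yx.
rewrite lerBrDr dual_addE dual_oppE.
have -> : - f y - f y + f x = f (x - y - y) by rewrite !linearB/=; lra.
rewrite (le_trans (ler_norm _))// (le_trans (dual_norm_ubound f _))//.
rewrite ler_wpM2l// rle_norm//.
  apply/rle_sub; rewrite -addrA -opprD opprB addrC subrK.
  exact: radd_ge0.
have /rle_sub xy0 := yx; apply/rle_sub.
by rewrite opprK addrCA; exact: radd_ge0.
Qed.

Lemma dual_lattice_norm f g : rabs f ≼ rabs g -> `|f| <= `|g|.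
Proof.
move=> fg; apply: dual_norm_le => // x.
rewrite (le_trans (dual_rabs_bound f x))//.
rewrite (le_trans (fg _ (rabs_ge0 x)))// -[`|x|]norm_rabs.
by apply: dual_rabs_le_norm; exact: rabs_ge0.
Qed.

HB.instance Definition _ :=
  NormedModule_Riesz_isBanachLattice.Build R (dual E) dual_lattice_norm.

End dual_lattice.

(** The topology generated by a family [p] of seminorms: [U] is open iff around
each of its points it contains a ball for finitely many seminorms of [p]. *)
Section seminorm_topology.
Variables (R : realType) (V : zmodType) (I : eqType) (p : I -> V -> R).

Definition seminorm_ball (s : seq I) (e : R) (x : V) : set V :=
  [set y | forall i, i \in s -> p i (y - x) < e].

Definition seminorm_open : set_system V :=
  [set U | forall x, U x ->
    exists (s : seq I) (e : R), 0 < e /\ seminorm_ball s e x `<=` U].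

Lemma seminorm_openT : seminorm_open setT.
Proof. by move=> x _; exists [::], 1. Qed.

Lemma seminorm_openI : setI_closed seminorm_open.
Proof.
move=> A B oA oB x [/oA[s [d [d0 sA]]] /oB[t [e [e0 tB]]]].
exists (s ++ t), (Num.min d e); split; first by rewrite lt_min d0.
move=> y xy; split; [apply: sA|apply: tB] => i it;
  have := xy i; rewrite mem_cat it ?orbT => /(_ isT);
  by rewrite lt_min => /andP[].
Qed.

Lemma seminorm_open_bigU (J : Type) (f : J -> set V) :
  (forall j, seminorm_open (f j)) -> seminorm_open (\bigcup_j f j).
Proof.
move=> fo x [j _ /fo[s [e [e0 sf]]]]; exists s, e; split => // y /sf fy.
by exists j.
Qed.

End seminorm_topology.

(** Copies of [E] and of [dual F] for the absolute weak and the absolute weak-*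
topologies; [compact] and [-->] then refer to these instead of the norm. *)
Definition abs_weak (R : realType) (E : banachLatticeType R) : Type := E.

Section abs_weak.
Variables (R : realType) (E : banachLatticeType R).

Definition abs_weak_seminorm (f : dual E) (x : E) : R := rabs f (rabs x).

HB.instance Definition _ := Choice.on (abs_weak E).
HB.instance Definition _ := isOpenTopological.Build (abs_weak E)
  (seminorm_openT abs_weak_seminorm) (seminorm_openI (p := abs_weak_seminorm))
  (seminorm_open_bigU (p := abs_weak_seminorm)).

Definition abs_weakly_compact (K : set E) := compact (K : set (abs_weak E)).

Definition abs_weakly_seq_compact (K : set E) :=
  forall u : nat -> E, (forall n, K (u n)) ->
    exists phi : nat -> nat, {homo phi : m n / (m < n)%N} /\
      exists2 x : E, K x &
        (u \o phi : nat -> abs_weak E) @ \oo --> (x : abs_weak E).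

End abs_weak.

Definition abs_weakstar (R : realType) (F : banachLatticeType R) : Type :=
  dual F.

Section abs_weakstar.
Variables (R : realType) (F : banachLatticeType R).

Definition abs_weakstar_seminorm (x : F) (f : dual F) : R := rabs f (rabs x).

HB.instance Definition _ := Choice.on (abs_weakstar F).
HB.instance Definition _ := isOpenTopological.Build (abs_weakstar F)
  (seminorm_openT abs_weakstar_seminorm)
  (seminorm_openI (p := abs_weakstar_seminorm))
  (seminorm_open_bigU (p := abs_weakstar_seminorm)).

Definition abs_weakstar_compact (K : set (dual F)) :=
  compact (K : set (abs_weakstar F)).

End abs_weakstar.

Definition separable (T : topologicalType) :=
  exists2 D : set T, countable D & dense D.

Definition closed_unit_ball (R : realType) (V : normedModType R) : set V :=
  [set x | `|x| <= 1].

(* Main.v *)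
Require Import Defs.
From mathcomp Require Import all_boot all_order all_algebra.
From mathcomp Require Import all_classical all_reals all_analysis.
From mathcomp Require Import lra.

(** The proof is Whitley's proof of the Eberlein-Smulian theorem, followed by a
passage from weak to absolute weak convergence. Let [F] be an ultrafilter
containing [K]; it has to be shown that [F] converges absolutely weakly to a
point of [K]. Write [p_f x = |f|(|x|)].

Sequential compactness makes [K] totally bounded for each [p_f]: otherwise one
could pick in [K] a sequence whose terms are [p_f]-separated, and no subsequence
of it would converge. Hence [F] contains arbitrarily small [p_f]-balls centred in
[K] ([ultrafilter_small_ball]). As [|f x| <= p_f x], every [f] has a limit
[phi f] along [F] ([ultrafilter_dual_cvg]).

The functional [phi] is evaluation at a point of [K] ([filter_limit_attained]).
A sequence [u] in [K] is built so that [f (u n)] tends to [phi f] for countably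
many [f], among them, for each rational combination [y] of the terms of [u], one
that detects the distance from [phi] to the evaluation at [y] up to a factor 2.
Let [x] in [K] be the limit of a subsequence of [u]. Then [phi] and the
evaluation at [x] agree on these [f], so the distance from [phi] to [y] is at most
[2 * `|x - y|]. By Hahn-Banach, [x] is in the norm closure of the combinations
[y] ([rat_comb_approx]), and so [phi] is the evaluation at [x].

It remains to upgrade [f @ F --> f x] for all [f] to [p_f (y - x) --> 0] along [F].
If the [p_f]-ball of radius [e] about [z] is in [F], then [p_f (z - x) <= e]: by
Hahn-Banach [p_f (z - x)] is the value at [z - x] of a functional [g <= p_f]
([abs_weak_seminorm_support]), and [g (z - x)] is the limit of [g (z - y)] along
[F]. Thus [F] contains every [p_f]-ball about [x].

Hahn-Banach is obtained from Zorn's lemma applied to the sublinear functionals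
themselves, since the minimal ones are linear ([minimal_sublinear_linear]). *)

Local Open Scope classical_set_scope.
Local Open Scope ring_scope.

Set Implicit Arguments.
Unset Strict Implicit.
Unset Printing Implicit Defensive.

Import Order.TTheory GRing.Theory Num.Theory.
Import numFieldNormedType.Exports.

(** * Sublinear functionals and the Hahn-Banach theorem *)

Section hahn_banach.
Variables (R : realType) (V : lmodType R).
Implicit Types (p q : V -> R) (x y z : V).

Definition sublinear p :=
  (forall x y, p (x + y) <= p x + p y) /\
  (forall (t : R) x, 0 <= t -> p (t *: x) <= t * p x).

Lemma sublinear0 p : sublinear p -> p 0 = 0.
Proof.
move=> [pD pZ]; apply/le_anti/andP; split.
  by have := pZ 0 0 (lexx _); rewrite scale0r mul0r.
by have := pD 0 0; rewrite addr0; lra.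
Qed.

Lemma sublinearN p x : sublinear p -> - p (- x) <= p x.
Proof.
by move=> sp; have := sp.1 x (- x); rewrite subrr sublinear0//; lra.
Qed.

Lemma sublinearZ p (t : R) x : sublinear p -> 0 <= t -> p (t *: x) = t * p x.
Proof.
move=> sp; rewrite le_eqVlt => /predU1P[<-|t0].
  by rewrite scale0r mul0r sublinear0.
apply/le_anti/andP; split; first by apply: sp.2; exact: ltW.
rewrite -ler_pdivlMl//.
have := sp.2 t^-1 (t *: x); rewrite scalerA mulVf ?gt_eqF// scale1r; apply.
by rewrite invr_ge0 ltW.
Qed.

(** A sublinear functional below [p] whose value at [- y] is at most [- p y]: a
minimal [p] equals it, which forces [p] to be additive; and a linear functional
below it agrees with [p] at [y]. *)
Definition slope_along p y z : R :=
  inf [set p (z + t *: y) - t * p y | t in [set t : R | 0 <= t]].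

Section slope.
Variables (p : V -> R) (y : V).
Hypothesis sp : sublinear p.

Let slope_lb z : has_lbound
  [set p (z + t *: y) - t * p y | t in [set t : R | 0 <= t]].
Proof.
exists (- p (- z)) => _ [t /= t0 <-].
have := sp.1 (z + t *: y) (- z); rewrite addrAC subrr add0r sublinearZ//; lra.
Qed.

Lemma slope_along_le z (t : R) : 0 <= t ->
  slope_along p y z <= p (z + t *: y) - t * p y.
Proof. by move=> t0; apply: ge_inf => //; exists t. Qed.

Lemma slope_along_ge z c :
  (forall t : R, 0 <= t -> c <= p (z + t *: y) - t * p y) ->
  c <= slope_along p y z.
Proof.
move=> h; apply: lb_le_inf; last by move=> _ [t /= t0 <-]; exact: h.
by exists (p (z + 0 *: y) - 0 * p y), 0 => /=.
Qed.

Lemma slope_along_le_self z : slope_along p y z <= p z.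
Proof.
by have := slope_along_le z (lexx 0); rewrite scale0r addr0 mul0r subr0.
Qed.

Lemma slope_along_sublinear : sublinear (slope_along p y).
Proof.
split=> [z w|c z].
  rewrite -lerBlDr; apply: slope_along_ge => t t0.
  rewrite lerBlDr -lerBlDl; apply: slope_along_ge => s s0.
  have := slope_along_le (z + w) (addr_ge0 t0 s0).
  have := sp.1 (z + t *: y) (w + s *: y).
  by rewrite addrACA -scalerDl; lra.
rewrite le_eqVlt => /predU1P[<-|c0].
  by rewrite scale0r mul0r (le_trans (slope_along_le_self 0))// sublinear0.
rewrite -ler_pdivrMl//; apply: slope_along_ge => t t0.
rewrite ler_pdivrMl//.
have ct0 : 0 <= c * t by rewrite mulr_ge0// ltW.
have := slope_along_le (c *: z) ct0.
by rewrite -scalerA -scalerDr (sublinearZ _ sp (ltW c0)); lra.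
Qed.

End slope.

(** The infimum over a chain is subadditive because the smaller of two members
bounds it at both points simultaneously. The lower bound [- p (- x)] makes the
infimum finite. *)
Lemma sublinear_chain_inf p (A : set (V -> R)) : A !=set0 ->
  (forall q, A q -> sublinear q /\ (forall x, q x <= p x)) ->
  (forall q r, A q -> A r -> (forall x, q x <= r x) \/ (forall x, r x <= q x)) ->
  exists2 q, sublinear q & forall r, A r -> forall x, q x <= r x.
Proof.
move=> [q0 Aq0] Ap Achain.
have lb x : has_lbound [set q x | q in A].
  exists (- p (- x)) => _ [q Aq <-]; have [sq qp] := Ap q Aq.
  by rewrite (le_trans _ (sublinearN x sq))// lerN2.
pose m x := inf [set q x | q in A].
have m_le q x : A q -> m x <= q x by move=> Aq; apply: ge_inf => //; exists q.
have m_ge x c : (forall q, A q -> c <= q x) -> c <= m x.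
  move=> h; apply: lb_le_inf; first by exists (q0 x), q0.
  by move=> _ [q Aq <-]; exact: h.
exists m; last by move=> r Ar x; exact: m_le.
split=> [x y|t x].
  rewrite -lerBlDr; apply: (m_ge) => q Aq; rewrite lerBlDr -lerBlDl.
  apply: (m_ge) => r Ar; rewrite lerBlDl.
  have [qr|rq] := Achain q r Aq Ar.
    rewrite (le_trans (m_le q _ Aq))// (le_trans ((Ap q Aq).1.1 _ _))//.
    by rewrite lerD2l.
  rewrite (le_trans (m_le r _ Ar))// (le_trans ((Ap r Ar).1.1 _ _))//.
  by rewrite lerD2r.
rewrite le_eqVlt => /predU1P[<-|t0].
  rewrite scale0r mul0r (le_trans (m_le q0 _ Aq0))// sublinear0//.
  by case: (Ap q0 Aq0).
rewrite -ler_pdivrMl//; apply: (m_ge) => q Aq; rewrite ler_pdivrMl//.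
by rewrite (le_trans (m_le q _ Aq))// (Ap q Aq).1.2// ltW.
Qed.

Lemma minimal_sublinear p : sublinear p ->
  exists2 q, sublinear q /\ (forall x, q x <= p x) &
    forall r, sublinear r -> (forall x, r x <= q x) -> r = q.
Proof.
move=> sp; pose T := {q : V -> R | sublinear q /\ forall x, q x <= p x}.
pose below (q r : T) := `[< forall x, sval r x <= sval q x >].
have [||||[q [sq qp]] qmin] := @Zorn T below.
- by move=> q; apply/asboolP.
- move=> q r s /asboolP qr /asboolP rs; apply/asboolP => x.
  exact: le_trans (qr x).
- move=> [q Hq] [r Hr] /asboolP/= qr /asboolP/= rq; apply: eq_exist.
  by apply/funext => x; apply/le_anti; rewrite qr rq.
- move=> A Atot; have [[a Aa]|A0] := pselect (A !=set0); last first.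
    (* The empty chain is bounded by [p] itself. *)
    exists (exist _ p (conj sp (fun x => lexx _))) => s As; exfalso.
    by apply: A0; exists s.
  have [|||q1 sq1 q1A] := @sublinear_chain_inf p [set sval q | q in A].
  + by exists (sval a), a.
  + by move=> _ [q Aq <-]; exact: (svalP q).
  + move=> _ _ [s As <-] [t At <-].
    by have [/asboolP h|/asboolP h] := Atot s t As At; [right|left].
  have q1p x : q1 x <= p x.
    rewrite (le_trans (q1A (sval a) _ x)) ?(svalP a).2//.
    by exists a.
  exists (exist _ q1 (conj sq1 q1p)) => s As; apply/asboolP => x /=.
  by apply: q1A; exists s.
exists q => // r sr rq.
have rp x : r x <= p x by exact: le_trans (rq x) (qp x).
by have /(congr1 sval) := qmin (exist _ r (conj sr rp)) (asboolT rq).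
Qed.

(** By minimality [slope_along q y] is [q]; at the parameter [t = 1] this reads
[q z <= q (z + y) - q y]. *)
Lemma minimal_sublinear_linear q : sublinear q ->
  (forall r, sublinear r -> (forall x, r x <= q x) -> r = q) -> linear q.
Proof.
move=> sq qmin.
have qD z y : q (z + y) = q z + q y.
  apply/le_anti; rewrite sq.1/=.
  have := slope_along_le y sq z ler01.
  rewrite (qmin _ (slope_along_sublinear y sq)) ?scale1r ?mul1r; first by lra.
  by move=> x; exact: slope_along_le_self.
have qN x : q (- x) = - q x.
  by apply/eqP; rewrite -addr_eq0 -qD addNr sublinear0.
move=> t x y; rewrite qD; congr (_ + _); have [t0|t0] := leP 0 t.
  exact: sublinearZ.
have -> : t *: x = - ((- t) *: x) by rewrite scaleNr opprK.
by rewrite qN sublinearZ ?oppr_ge0 ?ltW// mulNr opprK.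
Qed.

(** A minimal sublinear functional is taken below [slope_along p x] instead of
[p], as this keeps the value at [x] from dropping. *)
Lemma hahn_banach p x : sublinear p ->
  exists f : V -> R, [/\ linear f, forall y, f y <= p y & f x = p x].
Proof.
move=> sp; have [f [sf fp] fmin] := minimal_sublinear (slope_along_sublinear x sp).
have lf := minimal_sublinear_linear sf fmin.
have fle y : f y <= p y := le_trans (fp y) (slope_along_le_self x sp y).
exists f; split => //; apply/le_anti; rewrite fle/=.
have := le_trans (fp (- x)) (slope_along_le x sp (- x) ler01).
have := lf (-1) x 0.
rewrite scaleN1r addr0 sublinear0// addr0 scale1r addNr sublinear0// => ->.
by rewrite scaleN1r; lra.
Qed.

End hahn_banach.

(** * Functionals on normed spaces *)

Section duality.
Variables (R : realType) (V : normedModType R).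

Lemma dual_of_sublinear (p : V -> R) (M : R) x : sublinear p ->
  (forall y, p y <= M * `|y|) ->
  exists f : dual V, (forall y, f y <= p y) /\ f x = p x.
Proof.
move=> sp pM; have [f [lf fp fx]] := hahn_banach x sp.
have fM y : `|f y| <= M * `|y|.
  rewrite ler_norml (le_trans (fp y) (pM y)) andbT.
  have := le_trans (fp (- y)) (pM (- y)); rewrite normrN.
  have f0 : f 0 = 0.
    by have := lf 1 0 0; rewrite scaler0 addr0 scale1r; lra.
  have := lf 1 y (- y); rewrite !scale1r subrr f0; lra.
by exists (Dual (mem_dual_pred lf fM)).
Qed.

(** The Hahn-Banach functional of the distance to [A] vanishes on [A] and takes
at [x] the value of the distance. Homogeneity is only required approximately, so
that [A] can be a rational, hence countable, span. *)
Lemma approx_of_annihilator (A : set V) x : A 0 ->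
  (forall a b, A a -> A b -> A (a + b)) ->
  (forall (t e : R) a, A a -> 0 < e -> exists2 b, A b & `|t *: a - b| < e) ->
  (forall f : dual V, (forall a, A a -> f a = 0) -> f x = 0) ->
  forall e : R, 0 < e -> exists2 a, A a & `|x - a| < e.
Proof.
move=> A0 AD AZ ann; pose p y := inf [set `|y - a| | a in A].
have p_le y a : A a -> p y <= `|y - a|.
  move=> Aa; apply: ge_inf; last by exists a.
  by exists 0 => _ [b _ <-].
have p_ge y c : (forall a, A a -> c <= `|y - a|) -> c <= p y.
  move=> h; apply: lb_le_inf; first by exists `|y - 0|, 0.
  by move=> _ [a Aa <-]; exact: h.
have p_ge0 y : 0 <= p y by apply: (p_ge) => a _; exact: normr_ge0.
have p_norm y : p y <= 1 * `|y|.
  by rewrite mul1r -{2}[y]subr0; exact: p_le.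
have p_span a (t : R) : A a -> p (t *: a) = 0.
  move=> Aa; apply/le_anti; rewrite p_ge0 andbT.
  apply/ler_addgt0Pl => e e0; rewrite addr0.
  have [b Ab /ltW] := AZ t e a Aa e0; apply: le_trans; exact: p_le.
have pD y z : p (y + z) <= p y + p z.
  rewrite -lerBlDr; apply: (p_ge) => a Aa; rewrite lerBlDr -lerBlDl.
  apply: (p_ge) => b Ab; rewrite lerBlDl.
  rewrite (le_trans (p_le _ _ (AD _ _ Aa Ab)))//.
  by rewrite opprD addrACA ler_normD.
have sp : sublinear p.
  split=> // t y; rewrite le_eqVlt => /predU1P[<-|t0].
    by rewrite mul0r scale0r -(scale0r 0) p_span.
  rewrite -ler_pdivrMl//; apply: (p_ge) => a Aa; rewrite ler_pdivrMl//.
  have -> : t *: y = t *: (y - a) + t *: a by rewrite scalerBr subrK.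
  rewrite (le_trans (pD _ _))// p_span// addr0 (le_trans (p_norm _))//.
  by rewrite mul1r normrZ gtr0_norm.
have [f [fp fx]] := dual_of_sublinear x sp p_norm.
have px : p x = 0.
  rewrite -fx; apply: ann => a Aa; apply/le_anti.
  have := fp (- a); have := fp a.
  by rewrite -[in p a](scale1r a) -[in p (- a)]scaleN1r !p_span// linearN/=; lra.
move=> e e0; apply: contrapT => h.
suff : e <= p x by rewrite px leNgt e0.
apply: (p_ge) => a Aa; rewrite leNgt; apply/negP => xa.
by apply: h; exists a.
Qed.

End duality.

(** * Countable spans *)

(** Sequences whose terms are prescribed by the list of the earlier ones. *)
Lemma history_sequence (T : Type) (step : seq T -> T) :
  exists u : nat -> T, forall n, u n = step (mkseq u n).
Proof.
pose h n := iter n (fun l => rcons l (step l)) [::].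
exists (fun n => step (h n)) => n; congr step.
by elim: n => //= n IH; rewrite mkseqS -IH.
Qed.

Section rational_span.
Variables (R : realType) (V : normedModType R).
Implicit Types (v : nat -> V) (c : seq (rat * nat)).

(** Combinations are coded by lists of pairs coefficient-index, which form a
countable type and in which concatenation is addition. *)
Definition rat_comb v c : V := \sum_(qi <- c) ratr qi.1 *: v qi.2.

Lemma eq_rat_comb v w n c : (forall i, (i < n)%N -> v i = w i) ->
  all (fun qi => (qi.2 < n)%N) c -> rat_comb v c = rat_comb w c.
Proof.
move=> vw /allP cn; rewrite /rat_comb big_seq [RHS]big_seq.
by apply: eq_bigr => qi /cn qin; rewrite vw.
Qed.

Lemma rat_comb_bounded c : exists n, all (fun qi => (qi.2 < n)%N) c.
Proof.
elim: c => [|[q i] c [n cn]]; first by exists 0%N.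
exists (maxn i.+1 n) => /=; rewrite leq_maxl/=; apply: sub_all cn => qi /= h.
by rewrite (leq_trans h)// leq_maxr.
Qed.

Lemma rat_comb_approx v x :
  (forall f : dual V, (forall n, f (v n) = 0) -> f x = 0) ->
  forall e : R, 0 < e -> exists c, `|x - rat_comb v c| < e.
Proof.
move=> ann e e0.
have [||||a [c _ <-] xc] :=
  @approx_of_annihilator R V (range (rat_comb v)) x _ _ _ _ e e0.
- by exists [::] => //; rewrite /rat_comb big_nil.
- move=> _ _ [c _ <-] [d _ <-]; exists (c ++ d) => //.
  by rewrite /rat_comb big_cat.
- move=> t d _ [c _ <-] d0.
  have N0 : 0 < `|rat_comb v c| + 1 by rewrite ltr_wpDl.
  have dN : 0 < d / (`|rat_comb v c| + 1) by rewrite divr_gt0.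
  have [q tq] : exists q : rat, `|t - ratr q| < d / (`|rat_comb v c| + 1).
    have [||r [tq [q _ qr]]] := @dense_rat R (ball t (d / (`|rat_comb v c| + 1))).
    + by exists t; exact: ballxx.
    + exact: ball_open.
    + by exists q; move: tq; rewrite -ball_normE/= qr.
  exists (rat_comb v [seq (q * qi.1, qi.2) | qi <- c]); first by eexists.
  have -> : rat_comb v [seq (q * qi.1, qi.2) | qi <- c] = ratr q *: rat_comb v c.
    rewrite /rat_comb big_map scaler_sumr; apply: eq_bigr => qi _ /=.
    by rewrite rmorphM/= scalerA.
  rewrite -scalerBl normrZ (le_lt_trans (ler_wpM2r (normr_ge0 _) (ltW tq)))//.
  by rewrite mulrAC ltr_pdivrMr// ltr_pM2l// ltrDl.
- move=> f fA; apply: ann => n.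
  have := fA (rat_comb v [:: (1, n)]).
  rewrite /rat_comb big_seq1/= rmorph1 scale1r; apply.
  by exists [:: (1, n)] => //; rewrite /rat_comb big_seq1/= rmorph1 scale1r.
- by exists c.
Qed.

End rational_span.

(** * Whitley's construction *)

Section whitley.
Variables (R : realType) (V : normedModType R).
Implicit Types (f : dual V) (phi : dual V -> R).

Definition weakly_seq_compact (K : set V) :=
  forall u : nat -> V, (forall n, K (u n)) ->
    exists s : nat -> nat, {homo s : m n / (m < n)%N} /\
      exists2 x, K x & forall f, f (u (s n)) @[n --> \oo] --> f x.

(** The supremum of [defect phi x] over the unit ball plays the role of the norm
of [phi] minus the evaluation at [x]; truncating at 1 keeps it finite although
nothing bounds [phi] on the unit ball. *)
Definition defect phi x f : R := Num.min 1 `|phi f - f x|.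

Lemma defect_ge0 phi x f : 0 <= defect phi x f.
Proof. by rewrite /defect le_min ler01 normr_ge0. Qed.

Lemma defect_le_norm phi x y f : `|f| <= 1 ->
  defect phi x f <= defect phi y f + `|x - y|.
Proof.
move=> f1; have fxy : `|f y - f x| <= `|x - y|.
  rewrite distrC -linearB (le_trans (dual_norm_ubound f _))//.
  by rewrite ler_piMl.
have := ler_distD (f y) (phi f) (f x); have := normr_ge0 (x - y).
by rewrite /defect; case: (leP 1 `|phi f - f x|) => h1;
  case: (leP 1 `|phi f - f y|) => h2; lra.
Qed.

Lemma defect_almost_max phi x : exists f, `|f| <= 1 /\
  forall g, `|g| <= 1 -> defect phi x g <= 2 * defect phi x f.
Proof.
pose S := [set defect phi x f | f in [set f | `|f| <= 1]].
have S_ub : has_ubound S by exists 1 => _ [f _ <-]; rewrite /defect ge_min lexx.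
have S0 : S (defect phi x 0) by exists 0 => //=; rewrite normr0.
have le_S g : `|g| <= 1 -> defect phi x g <= sup S.
  by move=> g1; apply: ub_le_sup => //; exists g.
have [supS|supS] := leP (sup S) 0.
  exists 0; split=> [|g g1]; first by rewrite normr0.
  by have := le_S g g1; have := defect_ge0 phi x 0; lra.
have [||_ [f /= f1 <-] fS] := @sup_adherent R S (sup S / 2).
- by rewrite divr_gt0.
- by split=> //; exists (defect phi x 0).
exists f; split=> // g /le_S; lra.
Qed.

(** The Eberlein-Smulian theorem in filter form: a weak limit of a filter on [K],
a priori only a functional on the dual, is a point of [K]. *)
Lemma filter_limit_attained (K : set V) (F : set_system V) phi :
  ProperFilter F -> F K -> weakly_seq_compact K ->
  (forall f, f y @[y --> F] --> phi f) ->
  exists2 x, K x & forall f, phi f = f x.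
Proof.
move=> FF FK Kseq Fphi.
have [d dP] := choice (defect_almost_max phi).
(* The functional [d y] nearly attains the distance from [phi] to [y]. After a
   finite list [l] of points, the next one approximates [phi] at [d y] for those
   combinations [y] of [l] whose code is less than the length of [l]: finitely
   many conditions at each step, and each code is treated from some step on. *)
have near_phi (l : seq V) : exists z, K z /\ forall k c, (k < size l)%N ->
    unpickle k = Some c ->
    `|phi (d (rat_comb (nth 0 l) c)) - d (rat_comb (nth 0 l) c) z| <
      (size l).+1%:R^-1.
  have : \forall z \near F, K z /\ forall (k : 'I_(size l)) c,
    unpickle k = Some c ->
    `|phi (d (rat_comb (nth 0 l) c)) - d (rat_comb (nth 0 l) c) z| <
      (size l).+1%:R^-1.
    apply: filterI => //; apply: filter_forall => k.
    case: (unpickle k) => [c|]; last by apply: nearW.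
    have /cvgrPdist_lt/(_ (size l).+1%:R^-1) := Fphi (d (rat_comb (nth 0 l) c)).
    by rewrite invr_gt0 => /(_ (ltr0Sn _ _)); apply: filterS => z h _ [<-].
  move=> /filter_ex[z [Kz h]]; exists z; split=> // k c kl.
  exact: (h (Ordinal kl)).
have [step stepP] := choice near_phi.
have [u uE] := history_sequence step.
have Ku n : K (u n) by rewrite uE; case: (stepP (mkseq u n)).
have u_near c : \forall n \near \oo,
    `|phi (d (rat_comb u c)) - d (rat_comb u c) (u n)| < n.+1%:R^-1.
  have [N cN] := rat_comb_bounded c.
  near=> n.
  have -> : rat_comb u c = rat_comb (nth 0 (mkseq u n)) c.
    apply: (@eq_rat_comb _ _ _ _ N) => // i iN; rewrite nth_mkseq//.
    by rewrite (leq_trans iN)//; near: n; exact: nbhs_infty_ge.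
  have [_] := stepP (mkseq u n); rewrite -uE size_mkseq; apply; last exact: pickleK.
  by near: n; exact: nbhs_infty_gt.
have [s [s_mono [x Kx ux]]] := Kseq u Ku.
have s_oo : s n @[n --> \oo] --> \oo.
  have s_ge n : (n <= s n)%N.
    by elim: n => // n IH; rewrite (leq_ltn_trans IH)// s_mono.
  by apply/cvgnyPge => A; near=> n; rewrite (leq_trans _ (s_ge n))//; near: n;
    exact: nbhs_infty_ge.
have phi_x c : phi (d (rat_comb u c)) = d (rat_comb u c) x.
  have lim1 : d (rat_comb u c) (u n) @[n --> \oo] --> phi (d (rat_comb u c)).
    apply/cvgrPdist_lt => e e0; near=> n.
    apply: (@lt_trans _ _ n.+1%:R^-1); first by near: n; exact: u_near.
    by near: n; exact: (near_infty_natSinv_lt (PosNum e0)).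
  have lim2 := cvg_comp _ _ s_oo lim1.
  exact: (cvg_unique _ lim2 (ux _)).
(* The defect at [x] is within [`|x - y|] of the defect at a combination [y],
   which is at most twice its value at [d y]; there [phi] is evaluation at [x], so
   that value is at most [`|x - y|]. In total this is [3 * `|x - y|]. *)
have defect_small f e : `|f| <= 1 -> 0 < e -> defect phi x f <= e.
  move=> f1 e0.
  have [|c xc] := @rat_comb_approx _ _ u x _ (e / 3) (divr_gt0 e0 (ltr0Sn _ _)).
    move=> g gu; apply: (cvg_unique _ (ux g)) => //.
    by apply: cvg_near_cst; apply: nearW => n; rewrite gu.
  have [dc1 dmax] := dP (rat_comb u c).
  have := dmax f f1; have := defect_le_norm phi x (rat_comb u c) f1.
  suff : defect phi (rat_comb u c) (d (rat_comb u c)) <= `|x - rat_comb u c|.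
    by move: (`|_|) xc => r; lra.
  rewrite /defect ge_min phi_x -linearB (le_trans (dual_norm_ubound _ _)) ?orbT//.
  by rewrite ler_piMl.
have phi_unit f : `|f| <= 1 -> phi f = f x.
  move=> f1; have : defect phi x f <= 0.
    by apply/ler_addgt0Pl => e e0; rewrite addr0; exact: defect_small.
  by rewrite /defect ge_min normr_le0 subr_eq0 leNgt ltr01/= => /eqP.
exists x => // f; have [->|f0] := eqVneq f 0.
  by apply: phi_unit; rewrite normr0.
have nf0 : `|f| != 0 by rewrite normr_eq0.
have phiZ : phi (`|f|^-1 *: f) = `|f|^-1 * phi f.
  apply: (cvg_unique _ (Fphi _)) => //.
  by apply: cvgM; [exact: cvg_cst|exact: Fphi].
have := phi_unit (`|f|^-1 *: f).
rewrite normrZ normfV normr_id mulVf// phiZ => /(_ (lexx _)) h.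
by apply: (mulfI (invr_neq0 nf0)).
Unshelve. all: by end_near.
Qed.

End whitley.

(** * The absolute weak topology *)

Section absolute_weak_topology.
Variables (R : realType) (E : banachLatticeType R).
Implicit Types (x y : E) (f g : dual E) (K : set E).

Local Notation p := (@abs_weak_seminorm R E).

Lemma rabsN x : rabs (- x) = rabs x.
Proof.
have le y : rabs (- y) ≼ rabs y.
  by apply/rsupP; rewrite opprK; split; [exact: rabs_lbN|exact: rabs_lb].
by apply: rle_anti => //; rewrite -{1}[x]opprK.
Qed.

Lemma rabs_triangle x y : rabs (x + y) ≼ rabs x + rabs y.
Proof.
apply/rsupP; split; first by apply: rle_add; exact: rabs_lb.
by rewrite opprD; apply: rle_add; exact: rabs_lbN.
Qed.

Lemma rabs_scale_le (t : R) x : 0 <= t -> rabs (t *: x) ≼ t *: rabs x.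
Proof.
move=> t0; apply/rsupP; rewrite -scalerN; split; apply: rle_scale => //.
  exact: rabs_lb.
exact: rabs_lbN.
Qed.

Lemma dual_rabs_homo f x y : x ≼ y -> rabs f x <= rabs f y.
Proof.
move=> /rle_sub xy; rewrite -subr_ge0 -linearB.
exact: ((rabs_ge0 f : dual_le _ _) _ xy).
Qed.

Lemma abs_weak_seminorm_sublinear f : sublinear (p f).
Proof.
split=> [x y|t x t0]; rewrite /abs_weak_seminorm.
  by rewrite -linearD; apply: dual_rabs_homo; exact: rabs_triangle.
rewrite -[t * _]/(t *: _) -linearZ; apply: dual_rabs_homo.
exact: rabs_scale_le.
Qed.

Lemma abs_weak_seminormN f x : p f (- x) = p f x.
Proof. by rewrite /abs_weak_seminorm rabsN. Qed.

Lemma abs_weak_seminormC f x y : p f (x - y) = p f (y - x).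
Proof. by rewrite -abs_weak_seminormN opprB. Qed.

Lemma abs_weak_seminorm_triangle f x y z :
  p f (x - z) <= p f (x - y) + p f (y - z).
Proof.
rewrite (le_trans _ ((abs_weak_seminorm_sublinear f).1 _ _))//.
by rewrite addrA subrK.
Qed.

Lemma normr_dual_le_seminorm f x : `|f x| <= p f x.
Proof. exact: dual_rabs_bound. Qed.

(** This exhibits the seminorm as a supremum of continuous functionals, so it is
lower semicontinuous for weak limits. *)
Lemma abs_weak_seminorm_support f x :
  exists g, (forall y, g y <= p f y) /\ g x = p f x.
Proof.
apply: (@dual_of_sublinear _ _ _ `|f|); first exact: abs_weak_seminorm_sublinear.
move=> y; rewrite -[leRHS](congr1 (fun r => `|f| * r) (norm_rabs y)).
by apply: dual_rabs_le_norm; exact: rabs_ge0.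
Qed.

Lemma nbhs_seminorm_ball f x (e : R) : 0 < e ->
  nbhs (x : abs_weak E) [set y | p f (y - x) < e].
Proof.
move=> e0; apply: open_nbhs_nbhs; split; last first.
  by rewrite /= subrr sublinear0//; exact: abs_weak_seminorm_sublinear.
move=> y /= yx; exists [:: f], (e - p f (y - x)).
split=> [|z /(_ f (mem_head _ _))]; first by rewrite subr_gt0.
have := abs_weak_seminorm_triangle f z y x; rewrite /=; lra.
Qed.

Lemma cvg_abs_weak (F : set_system E) x : Filter F ->
  (forall f e, 0 < e -> F [set y | p f (y - x) < e]) ->
  (F : set_system (abs_weak E)) --> (x : abs_weak E).
Proof.
move=> FF Fx A; rewrite nbhsE => -[B [oB Bx] BA].
have [l [e [e0 lB]]] := oB x Bx.
suff : F (seminorm_ball p l e x) by apply: filterS => y /lB /BA.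
elim: l {lB} => [|f l IH]; first by apply: filterS filterT.
apply: filterS (filterI (Fx f e e0) IH) => y [yf yl] g.
by rewrite inE => /predU1P[->|/yl].
Qed.

Lemma abs_weakly_seq_compact_weakly K :
  abs_weakly_seq_compact K -> weakly_seq_compact K.
Proof.
move=> Kseq u /Kseq[s [s_mono [x Kx ux]]]; exists s; split=> //; exists x => // f.
apply/cvgrPdist_lt => e e0.
have : \forall n \near \oo, p f (u (s n) - x) < e.
  exact: ux _ (nbhs_seminorm_ball f x e0).
apply: filterS => n /=; apply: le_lt_trans.
by rewrite distrC -linearB normr_dual_le_seminorm.
Qed.

(** If no small ball belonged to the ultrafilter, the complements of finitely many
of them would still meet [K], which gives a separated sequence in [K]. *)
Lemma ultrafilter_small_ball K (F : set_system E) f (e : R) :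
  abs_weakly_seq_compact K -> UltraFilter F -> F K -> 0 < e ->
  exists2 x, K x & F [set y | p f (y - x) < e].
Proof.
move=> Kseq UF FK e0; apply: contrapT => no_ball.
have far x : K x -> F [set y | e <= p f (y - x)].
  move=> Kx; have [Fb|] := in_ultra_setVsetC [set y | p f (y - x) < e] UF.
    by exfalso; apply: no_ball; exists x.
  by apply: filterS => y /= /negP; rewrite -leNgt.
(* Only the entries of [l] lying in [K] are avoided; all terms of the sequence
   obtained are in [K]. *)
have next (l : seq E) : exists y, K y /\
    forall x, x \in l -> K x -> e <= p f (y - x).
  suff : F [set y | forall x, x \in l -> K x -> e <= p f (y - x)].
    by move=> /(filterI FK)/filter_ex.
  elim: l => [|a l IH]; first by apply: filterS filterT.
  have [Ka|nKa] := pselect (K a).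
    apply: filterS (filterI (far a Ka) IH) => y [ya yl] x.
    by rewrite inE => /predU1P[->|/yl].
  by apply: filterS IH => y yl x; rewrite inE => /predU1P[->|/yl].
have [step stepP] := choice next.
have [u uE] := history_sequence step.
have Ku n : K (u n) by rewrite uE; case: (stepP (mkseq u n)).
have u_far m n : (m < n)%N -> e <= p f (u n - u m).
  move=> mn; rewrite [u n]uE; apply: (stepP (mkseq u n)).2 => //.
  by apply/mapP; exists m => //; rewrite mem_iota.
have [s [s_mono [x Kx ux]]] := Kseq u Ku.
have [N _ NP] := ux _ (nbhs_seminorm_ball f x (divr_gt0 e0 (ltr0Sn R 1))).
have := u_far _ _ (s_mono N N.+1 (ltnSn N)).
have := NP N (leqnn N); have := NP N.+1 (leqnSn N).
have := abs_weak_seminorm_triangle f (u (s N.+1)) x (u (s N)).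
by rewrite (abs_weak_seminormC f x)/=; lra.
Qed.

Lemma ultrafilter_dual_cvg K (F : set_system E) f :
  abs_weakly_seq_compact K -> UltraFilter F -> F K ->
  cvg (f y @[y --> F]).
Proof.
move=> Kseq UF FK; apply: R_complete; apply/cauchyP => e e0.
have [x Kx Fx] := ultrafilter_small_ball f Kseq UF FK e0.
exists (f x); change (F [set y | ball (f x) e (f y)]).
apply: filterS Fx => y /=; rewrite -ball_normE/=; apply: le_lt_trans.
by rewrite distrC -linearB normr_dual_le_seminorm.
Qed.

End absolute_weak_topology.

(** * Compactness *)

Theorem theorem2p9 (R : realType) (E : banachLatticeType R) (K : set E)
  (Kseq : abs_weakly_seq_compact K)
  (hE : separable E \/
        abs_weakstar_compact (@closed_unit_ball R (dual (dual E)))) :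
  abs_weakly_compact K.
Proof.
rewrite /abs_weakly_compact compact_ultra => F UF FK.
have UF' : UltraFilter (F : set_system E) := UF.
pose phi (f : dual E) : R := lim (f y @[y --> (F : set_system E)]).
have Fphi (f : dual E) : f y @[y --> (F : set_system E)] --> phi f.
  exact: ultrafilter_dual_cvg Kseq UF' FK.
have [x Kx phi_x] := @filter_limit_attained R E K F phi _ FK
  (abs_weakly_seq_compact_weakly Kseq) Fphi.
exists x; split=> //; apply: cvg_abs_weak => f e e0.
have e20 : 0 < e / 2 by rewrite divr_gt0.
have [z Kz Fz] := ultrafilter_small_ball f Kseq UF' FK e20.
suff zx : abs_weak_seminorm f (z - x) <= e / 2.
  apply: filterS Fz => y /= yz.
  by have := abs_weak_seminorm_triangle f y z x; lra.
have [g [gp <-]] := abs_weak_seminorm_support f (z - x).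
rewrite linearB/= -phi_x lerBlDr -lerBlDl.
apply: (cvgr_to_ge (Fphi g)); apply: filterS Fz => y /= yz.
have := gp (z - y); rewrite linearB/= abs_weak_seminormC; lra.
Qed.
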